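(* Let $G$ and $H$ be finite simple graphs with $n$ and $m$ vertices respectively ($n,m\ge 1$, disjoint vertex sets). Then $B'(G+H)=B(G+H)=\min\{B'(G),B'(H),a\}$, where $a=\gamma(G)+\gamma(H)$ if $n=1$ or $m=1$ or $\gamma(G)=\gamma(H)=1$; $a=3$ if $n\ge 2$, $m\ge 2$, and ($\gamma(G)\le 2$ or $\gamma(H)\le 2$) but not $\gamma(G)=\gamma(H)=1$; $a=4$ if $\gamma(G)\ge 3$ and $\gamma(H)\ge 3$.
   Context: The join $G+H$ has vertex set $V(G)\cup V(H)$ and edge set $E(G)\cup E(H)\cup\{xy:x\in V(G),y\in V(H)\}$. $\gamma(G)$ is the domination number of $G$ (minimum size of a set $D$ such that every vertex is in $D$ or adjacent to a vertex of $D$). In a graph each vertex is black or white; in the zero forcing process, if a black vertex has exactly one white neighbor $w$, then $w$ becomes black, iterated. A set $S$ of initially black vertices is a failed zero forcing set if the process does not make all vertices black, and then $V(G)\setminus S$ is a zero blocking set. $B(G)$ is the minimum size of a zero blocking set of $G$; $B'(G)$ is the minimum size of a zero blocking set of size at least two, with $B'(G)=\infty$ if none exists (e.g. when $G$ has one vertex).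
   Formalization: B' is taken over zero blocking sets of size at least two all of whose vertices stay white (no force possible); with arbitrary zero blocking sets the formula fails for graphs with an isolated vertex, e.g. G = K_1 ∪ P_4, H = K_1, where B'(G) = 2 but B(G+H) = 3. *)

(* Defs.v *)
From HB Require Import structures.
From mathcomp Require Import all_boot.

Set Implicit Arguments.
Unset Strict Implicit.
Unset Printing Implicit Defensive.

Record sgraph := SGraph {
  vertex :> finType;
  adj : rel vertex;
  adj_sym : symmetric adj;
  adj_irrefl : irreflexive adj }.

Section Join.
Variables G H : sgraph.

Definition join_adj : rel (G + H)%type := fun x y =>
  match x, y with
  | inl u, inl v => adj u v
  | inr u, inr v => adj u v
  | _, _ => true
  end.

Lemma join_adj_sym : symmetric join_adj.
Proof. by move=> [x|x] [y|y] //=; rewrite adj_sym. Qed.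

Lemma join_adj_irrefl : irreflexive join_adj.
Proof. by move=> [x|x] /=; rewrite adj_irrefl. Qed.

Definition join : sgraph := SGraph join_adj_sym join_adj_irrefl.
End Join.

(* Natural numbers extended by infinity, which is represented by None. *)
Definition omin (x y : option nat) : option nat :=
  match x, y with
  | Some a, Some b => Some (minn a b)
  | None, _ => y
  | _, None => x
  end.

Lemma ominA : associative omin.
Proof. by move=> [a|] [b|] [c|] //=; rewrite minnA. Qed.

Lemma ominC : commutative omin.
Proof. by move=> [a|] [b|] //=; rewrite minnC. Qed.

Lemma omin0 : left_id None omin.
Proof. by case. Qed.

HB.instance Definition _ := Monoid.isComLaw.Build _ None omin ominA ominC omin0.

(* None when no set satisfies P. *)
Definition min_size (T : finType) (P : pred {set T}) : option nat :=
  \big[omin/None]_(A : {set T} | P A) Some #|A|.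

Section Invariants.
Variable G : sgraph.
Implicit Types (D S Z : {set G}) (v w : G).

Definition dominating D : bool :=
  [forall v, (v \in D) || [exists u in D, adj v u]].

(* The whole vertex set is dominating, so the minimum is over a nonempty
   family. *)
Definition domination_number : nat :=
  #|[arg min_(D < [set: G] | dominating D) #|D| ]|.

Definition white_neighbors S v : {set G} := [set w | adj v w & w \notin S].

(* One round: every black vertex with exactly one white neighbor forces it. *)
Definition force_round S : {set G} :=
  S :|: [set w | [exists v in S, white_neighbors S v == [set w]]].

(* The final set of black vertices: by force_process_max below, #|G| rounds
   suffice. *)
Definition force_process S : {set G} := iter #|G| force_round S.

Definition failed_zero_forcing S : bool := force_process S != [set: G].

Definition zero_blocking Z : bool := failed_zero_forcing (~: Z).

Definition stalled S : bool := force_round S == S.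

Definition B : option nat := min_size zero_blocking.

(* The minimum runs over the zero blocking sets whose complement is stalled,
   i.e. whose vertices all remain white. Without this restriction an isolated
   vertex v would make every pair {v, w} count, although only v blocks
   anything, and the formula for joins would fail: for G the disjoint union of
   K_1 and P_4, and H = K_1, the minimum for G would be 2 while
   B (join G H) = 3. Dropping the restriction does not change the value for
   graphs without isolated vertices, and imposing it in B would not change B. *)
Definition B' : option nat :=
  min_size [pred Z | [&& zero_blocking Z, stalled (~: Z) & 2 <= #|Z|]].

Lemma force_process_stalled S : stalled (force_process S).
Proof.
have sub k : iter k force_round S \subset iter k.+1 force_round S.
  by rewrite iterS subsetUl.
have grow k : stalled (iter k force_round S) || (k <= #|iter k force_round S|).
  elim: k => [|k /orP[st|le_k]]; first by rewrite orbT.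
    by rewrite iterS (eqP st) st.
  case: (boolP (stalled (iter k force_round S))) => [st|nst].
    by rewrite iterS (eqP st) st.
  apply/orP; right; apply: leq_ltn_trans le_k _; apply: proper_card.
  by rewrite properEneq sub andbT eq_sym.
have /orP[//|le_n] := grow #|G|.
have fullE : force_process S = [set: G].
  by apply/eqP; rewrite eqEcard subsetT cardsT.
by rewrite /stalled fullE /force_round setTU.
Qed.

Lemma force_process_max S k : iter k force_round S \subset force_process S.
Proof.
have mono i j : i <= j -> iter i force_round S \subset iter j force_round S.
  move=> /subnK <-; elim: (j - i) => [|d IH] //=.
  exact: subset_trans IH (subsetUl _ _).
case: (leqP k #|G|) => [/mono //|/ltnW le_k].
rewrite -(subnK le_k) iterD -/(force_process S).
elim: (k - #|G|) => [|d IH] //=.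
suff -> : iter d force_round (force_process S) = force_process S.
  by rewrite (eqP (force_process_stalled S)).
by elim: d {IH} => //= d ->; apply/eqP/force_process_stalled.
Qed.
End Invariants.

(* The last case is the one with both domination numbers at least 3, which
   already forces both graphs to have at least two vertices. *)
Definition join_constant (G H : sgraph) : nat :=
  let g := domination_number G in
  let h := domination_number H in
  if [|| #|G| == 1, #|H| == 1 | (g == 1) && (h == 1)] then g + h
  else if (g <= 2) || (h <= 2) then 3
  else 4.

(* Main.v *)
Require Import Defs.
From mathcomp Require Import all_boot.
From mathcomp Require Import zify.

(** Call [Z] a fort if it is nonempty and no vertex outside [Z] has exactly one
    neighbor in [Z].  The vertices that stay white form a fort, so [B] is the
    least size of a fort, and [B'] the least size of a fort with at least two
    vertices.  A fort with a single vertex consists of an isolated vertex, and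
    [G + H] has none, so the two numbers agree.

    Split a fort of [G + H] into its traces [X] on [G] and [Y] on [H].  If [Y]
    is empty, [X] is a fort of [G] with [#|X| != 1], because every vertex of [H]
    sees all of [X].  If both traces are nonempty, the fort condition says
    exactly that [X] dominates [G] when [#|Y| = 1] and [Y] dominates [H] when
    [#|X| = 1].  Supersets of dominating sets dominate, so which sizes of [X]
    and [Y] occur is a matter of the domination numbers alone, and minimizing
    their sum is arithmetic. *)

Set Implicit Arguments.
Unset Strict Implicit.
Unset Printing Implicit Defensive.

Definition oleq (x : option nat) (k : nat) : bool :=
  if x is Some a then a <= k else false.

Lemma eq_oleq x y : oleq x =1 oleq y -> x = y.
Proof.
case: x y => [a|] [b|] //= eq_xy.
- by congr Some; have /= := eq_xy a; have /= := eq_xy b; lia.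
- by have := eq_xy a; rewrite /= leqnn.
- by have := eq_xy b; rewrite /= leqnn.
Qed.

Lemma oleq_omin x y k : oleq (omin x y) k = oleq x k || oleq y k.
Proof. by case: x y => [a|] [b|] //=; rewrite ?orbF // geq_min. Qed.

Lemma superset_of_card (T : finType) (A : {set T}) k :
  #|A| <= k <= #|T| -> exists2 C : {set T}, A \subset C & #|C| = k.
Proof.
move=> /andP[leAk lekT].
have : 0 < #|[set E : {set T} | E \subset ~: A & #|E| == k - #|A|]|.
  by rewrite cards_draws bin_gt0 [#|~: A|]cardsCs setCK leq_sub2r.
case/card_gt0P=> E; rewrite inE => /andP[sEAc /eqP cardE].
exists (A :|: E); first exact: subsetUl.
rewrite cardsU cardE [A :&: E](_ : _ = set0) ?cards0 ?subn0 ?subnKC //.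
by apply/disjoint_setI0; rewrite disjoint_sym disjoints_subset.
Qed.

Section MinSize.
Variable T : finType.
Implicit Types (A : {set T}) (P Q : pred {set T}) (k : nat).

Lemma oleq_min_sizeP P k :
  reflect (exists2 A, P A & #|A| <= k) (oleq (min_size P) k).
Proof.
rewrite /min_size (big_morph (oleq^~ k) (fun x y => oleq_omin x y k) (erefl _)).
rewrite big_has_cond; apply: (iffP hasP) => [[A _ /andP[]]|[A PA leAk]].
  by exists A.
by exists A; rewrite ?mem_index_enum //= PA.
Qed.

Lemma eq_min_size P Q : P =1 Q -> min_size P = min_size Q.
Proof. by move=> eqPQ; apply: eq_bigl. Qed.

Lemma min_size_Some P k :
    (exists2 A, P A & #|A| = k) -> (forall A, P A -> k <= #|A|) ->
  min_size P = Some k.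
Proof.
move=> [A PA cardA] k_min; apply: eq_oleq => j.
apply/oleq_min_sizeP/idP => /= [[C /k_min]|le_kj]; first exact: leq_trans.
by exists A; rewrite // cardA.
Qed.

Lemma min_size_cofinal P Q :
    subpred Q P -> (forall A, P A -> exists2 C, Q C & #|C| <= #|A|) ->
  min_size P = min_size Q.
Proof.
move=> subQP refine; apply: eq_oleq => k.
apply/oleq_min_sizeP/oleq_min_sizeP => -[A]; last by exists A; rewrite ?subQP.
by case/refine=> C QC leCA leAk; exists C; rewrite // (leq_trans leCA).
Qed.

End MinSize.

Section SumSet.
Variables T1 T2 : finType.
Implicit Types (X : {set T1}) (Y : {set T2}) (Z : {set T1 + T2}).

Definition sum_set X Y : {set T1 + T2} :=
  [set z | match z with inl x => x \in X | inr y => y \in Y end].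

Lemma sum_set_preim Z : sum_set (inl @^-1: Z) (inr @^-1: Z) = Z.
Proof. by apply/setP=> -[x|y]; rewrite !inE. Qed.

Lemma card_sum_set X Y : #|sum_set X Y| = #|X| + #|Y|.
Proof.
rewrite -!sum1_card big_sumType /=.
by congr (_ + _); apply: eq_bigl => u; rewrite inE.
Qed.

Definition meets_both Z : bool :=
  (inl @^-1: Z != set0) && (inr @^-1: Z != set0).

Lemma meets_both_sum_set X Y :
  meets_both (sum_set X Y) = (0 < #|X|) && (0 < #|Y|).
Proof.
rewrite /meets_both -!card_gt0.
by congr ((0 < _) && (0 < _)); apply: eq_card => u; rewrite !inE.
Qed.

Lemma min_size_sum (P : pred {set T1 + T2}) :
  min_size P =
  omin (min_size (fun X => P (sum_set X set0)))
       (omin (min_size (fun Y => P (sum_set set0 Y)))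
             (min_size [pred Z | P Z && meets_both Z])).
Proof.
apply: eq_oleq => k; rewrite !oleq_omin; apply/oleq_min_sizeP/or3P.
  case=> Z PZ; rewrite -{1}(sum_set_preim Z) card_sum_set => le_k.
  have [Y0|Y0] := eqVneq (inr @^-1: Z) set0.
    constructor 1; apply/oleq_min_sizeP; exists (inl @^-1: Z).
      by rewrite -Y0 sum_set_preim.
    by rewrite Y0 cards0 addn0 in le_k.
  have [X0|X0] := eqVneq (inl @^-1: Z) set0.
    constructor 2; apply/oleq_min_sizeP; exists (inr @^-1: Z).
      by rewrite -X0 sum_set_preim.
    by rewrite X0 cards0 in le_k.
  constructor 3; apply/oleq_min_sizeP; exists Z.
    by rewrite /= PZ /meets_both X0 Y0.
  by rewrite -(sum_set_preim Z) card_sum_set.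
case=> /oleq_min_sizeP[].
- by move=> X PX; exists (sum_set X set0); rewrite // card_sum_set cards0 addn0.
- by move=> Y PY; exists (sum_set set0 Y); rewrite // card_sum_set cards0.
- by move=> Z /andP[PZ _]; exists Z.
Qed.

End SumSet.

Section Graph.
Variable G : sgraph.
Implicit Types (D X Z : {set G}) (u v w : G) (k s : nat).

Definition neighbors_in Z v : {set G} := [set w in Z | adj v w].

(* The number k counts white neighbors outside G common to all vertices of G:
   in a join, those in the other graph. *)
Definition unforced k Z : bool :=
  [forall v in ~: Z, #|neighbors_in Z v| + k != 1].

Definition fort Z : bool := (Z != set0) && unforced 0 Z.

Lemma unforcedP k Z :
  reflect (forall v, v \notin Z -> #|neighbors_in Z v| + k != 1) (unforced k Z).
Proof.
apply: (iffP forall_inP) => unf v vZ; apply: unf; first by rewrite inE.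
by rewrite inE in vZ.
Qed.

Lemma unforced_gt1 k Z : 1 < k -> unforced k Z.
Proof. by move=> k_gt1; apply/unforcedP => v _; lia. Qed.

Lemma unforced_set0 k : 0 < #|G| -> unforced k set0 = (k != 1).
Proof.
move=> /card_gt0P[x _].
have no_neighbor v : #|neighbors_in set0 v| = 0.
  by apply/eqP; rewrite cards_eq0; apply/eqP/setP=> w; rewrite !inE.
apply/unforcedP/idP => [/(_ x)|k_neq1 v _]; last by rewrite no_neighbor.
by rewrite no_neighbor inE; apply.
Qed.

Lemma white_neighborsC Z v : white_neighbors (~: Z) v = neighbors_in Z v.
Proof. by apply/setP=> w; rewrite !inE negbK andbC. Qed.

Lemma unforced0 Z : unforced 0 Z = stalled (~: Z).
Proof.
apply/unforcedP/eqP => [unf|stable v vZ].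
  apply/setUidPl/subsetP=> w; rewrite inE => /exists_inP[v].
  rewrite inE white_neighborsC => /unf no1 /eqP forced.
  by rewrite forced cards1 in no1.
rewrite addn0; apply/negP=> /cards1P[w forced].
have : w \in ~: Z.
  rewrite -stable !inE; apply/orP; right; apply/exists_inP; exists v.
    by rewrite inE.
  by rewrite white_neighborsC forced.
by have := set11 w; rewrite -forced !inE => /andP[->].
Qed.

Lemma unforced1 D : unforced 1 D = dominating D.
Proof.
apply/unforcedP/forallP => dom v.
  case: (boolP (v \in D)) => //= /dom.
  rewrite addn1 eqSS -lt0n => /card_gt0P[u]; rewrite inE => /andP[uD vu].
  by apply/exists_inP; exists u.
move=> vD; have := dom v; rewrite (negPf vD) /= => /exists_inP[u uD vu].
by rewrite addn1 eqSS -lt0n; apply/card_gt0P; exists u; rewrite inE uD.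
Qed.

Lemma zero_blocking_stalled Z :
  stalled (~: Z) -> zero_blocking Z = (Z != set0).
Proof.
move=> /eqP stable; rewrite /zero_blocking /failed_zero_forcing /force_process.
have -> n : iter n (@force_round G) (~: Z) = ~: Z by elim: n => //= n ->.
by rewrite -setC0 (inj_eq (@setC_inj _)).
Qed.

Lemma fortE Z : fort Z = zero_blocking Z && stalled (~: Z).
Proof.
rewrite /fort unforced0; case: (boolP (stalled _)) => [stable|]; last first.
  by rewrite !andbF.
by rewrite zero_blocking_stalled.
Qed.

Lemma zero_blocking_fort Z :
  zero_blocking Z -> exists2 F, fort F & #|F| <= #|Z|.
Proof.
move=> blockZ; exists (~: force_process (~: Z)).
  rewrite /fort unforced0 setCK force_process_stalled andbT.
  by rewrite -setCT (inj_eq (@setC_inj _)).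
by apply/subset_leq_card; rewrite subCset (force_process_max _ 0).
Qed.

Lemma B_min_fort : B G = min_size fort.
Proof.
apply: min_size_cofinal; last exact: zero_blocking_fort.
by move=> Z; rewrite fortE => /andP[].
Qed.

Lemma B'_min_fort : B' G = min_size [pred Z | fort Z && (1 < #|Z|)].
Proof. by apply: eq_min_size => Z; rewrite /= fortE andbA. Qed.

Lemma fort_card_gt1 Z : (forall v, exists w, adj v w) -> fort Z -> 1 < #|Z|.
Proof.
move=> no_isolated /andP[Z_neq0 /unforcedP unfZ].
rewrite ltn_neqAle eq_sym card_gt0 Z_neq0 andbT; apply/negP=> /cards1P[v Zv].
have [w vw] := no_isolated v; have wZ : w \notin Z.
  by rewrite Zv inE; apply: contraTneq vw => ->; rewrite adj_irrefl.
have /cards1P : exists u, neighbors_in Z w = [set u].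
  exists v; apply/setP=> u; rewrite Zv !inE.
  by case: eqP => // ->; rewrite adj_sym.
by rewrite -[#|_|]addn0 (negPf (unfZ w wZ)).
Qed.

Lemma B'_no_isolated : (forall v, exists w, adj v w) -> B' G = B G.
Proof.
move=> no_isolated; rewrite B'_min_fort B_min_fort; apply: eq_min_size => Z /=.
by apply/andb_idr/fort_card_gt1.
Qed.

Lemma dominatingT : dominating [set: G].
Proof. by apply/forallP=> v; rewrite inE. Qed.

Lemma domination_number_leP k :
  reflect (exists2 D : {set G}, dominating D & #|D| <= k)
          (domination_number G <= k).
Proof.
rewrite /domination_number; case: arg_minnP => [|D domD minD].
  exact: dominatingT.
apply: (iffP idP) => [leDk|[C domC]]; first by exists D.
exact/leq_trans/minD.
Qed.

Lemma domination_number_le D : dominating D -> domination_number G <= #|D|.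
Proof. by move=> domD; apply/domination_number_leP; exists D. Qed.

Lemma domination_number_bounds :
  0 < #|G| -> 0 < domination_number G <= #|G|.
Proof.
move=> G_gt0; rewrite -cardsT domination_number_le ?dominatingT // andbT.
rewrite ltnNge; apply/domination_number_leP => -[D domD].
rewrite leqn0 cards_eq0 => /eqP D0.
by rewrite D0 -unforced1 unforced_set0 in domD.
Qed.

Lemma dominatingS X D : X \subset D -> dominating X -> dominating D.
Proof.
move=> /subsetP sXD /forallP domX; apply/forallP=> v.
have /orP[/sXD-> //|/exists_inP[u uX vu]] := domX v.
by apply/orP; right; apply/exists_inP; exists u; rewrite ?sXD.
Qed.

Lemma ex_unforced_card k s :
    0 < k -> s <= #|G| -> (k = 1 -> domination_number G <= s) ->
  exists2 X, unforced k X & #|X| = s.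
Proof.
move=> k_gt0 le_sG le_dom.
have [k_gt1|k_le1] := ltnP 1 k.
  have [|X _ cardX] := @superset_of_card G set0 s; first by rewrite cards0.
  by exists X; rewrite ?unforced_gt1.
have k1 : k = 1 by lia.
have /domination_number_leP[D domD leDs] := le_dom k1.
have [|X sDX cardX] := @superset_of_card G D s; first by rewrite leDs.
by exists X; rewrite // k1 unforced1 (dominatingS sDX).
Qed.

End Graph.

Section Join.
Variables G H : sgraph.
Implicit Types (X : {set G}) (Y : {set H}) (s t : nat).

Lemma card_neighbors_in_inl X Y (u : G) :
  #|neighbors_in (sum_set X Y : {set join G H}) (inl u)| =
  #|neighbors_in X u| + #|Y|.
Proof.
rewrite -card_sum_set; apply: eq_card.
by case=> w; rewrite !inE /= ?andbT.
Qed.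

Lemma card_neighbors_in_inr X Y (u : H) :
  #|neighbors_in (sum_set X Y : {set join G H}) (inr u)| =
  #|neighbors_in Y u| + #|X|.
Proof.
rewrite addnC -card_sum_set; apply: eq_card.
by case=> w; rewrite !inE /= ?andbT.
Qed.

Lemma unforced_join X Y :
  unforced 0 (sum_set X Y : {set join G H}) =
  unforced #|Y| X && unforced #|X| Y.
Proof.
apply/unforcedP/andP => [unf|[/unforcedP unfX /unforcedP unfY] [u|u]].
- split; apply/unforcedP => u uN.
    by have := unf (inl u); rewrite inE card_neighbors_in_inl addn0 => /(_ uN).
  by have := unf (inr u); rewrite inE card_neighbors_in_inr addn0 => /(_ uN).
- by rewrite inE card_neighbors_in_inl addn0 => /unfX.
- by rewrite inE card_neighbors_in_inr addn0 => /unfY.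
Qed.

Lemma fort_join X Y :
  fort (sum_set X Y : {set join G H}) =
  [&& 0 < #|X| + #|Y|, unforced #|Y| X & unforced #|X| Y].
Proof. by rewrite /fort unforced_join -card_gt0 card_sum_set. Qed.

Lemma fort_join_set0r X : 0 < #|H| ->
  fort (sum_set X set0 : {set join G H}) = fort X && (1 < #|X|).
Proof.
move=> H_gt0; rewrite fort_join cards0 unforced_set0 // /fort -card_gt0; lia.
Qed.

Lemma fort_join_set0l Y : 0 < #|G| ->
  fort (sum_set set0 Y : {set join G H}) = fort Y && (1 < #|Y|).
Proof.
move=> G_gt0; rewrite fort_join cards0 unforced_set0 // /fort -card_gt0; lia.
Qed.

Definition trace_sizes s t : Prop :=
  [/\ 0 < s <= #|G|, 0 < t <= #|H|,
      t = 1 -> domination_number G <= s & s = 1 -> domination_number H <= t].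

Lemma fort_trace_sizes X Y :
  fort (sum_set X Y : {set join G H}) -> meets_both (sum_set X Y) ->
  trace_sizes #|X| #|Y|.
Proof.
rewrite fort_join meets_both_sum_set => /and3P[_ unfX unfY] /andP[X_gt0 Y_gt0].
split; rewrite ?X_gt0 ?Y_gt0 ?max_card // => card1.
- by apply: domination_number_le; rewrite -unforced1 -card1.
- by apply: domination_number_le; rewrite -unforced1 -card1.
Qed.

Lemma trace_sizes_fort s t : trace_sizes s t ->
  exists2 Z : {set join G H}, fort Z && meets_both Z & #|Z| = s + t.
Proof.
case=> /andP[s_gt0 le_sG] /andP[t_gt0 le_tH] domG domH.
have [X unfX cardX] : exists2 X : {set G}, unforced t X & #|X| = s.
  by apply: ex_unforced_card.
have [Y unfY cardY] : exists2 Y : {set H}, unforced s Y & #|Y| = t.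
  by apply: ex_unforced_card.
exists (sum_set X Y); last by rewrite card_sum_set cardX cardY.
rewrite fort_join meets_both_sum_set cardX cardY.
by rewrite addn_gt0 s_gt0 t_gt0 unfX unfY.
Qed.

Hypotheses (G_gt0 : 0 < #|G|) (H_gt0 : 0 < #|H|).

Lemma join_no_isolated (z : join G H) : exists w, adj z w.
Proof.
have [/card_gt0P[x _] /card_gt0P[y _]] := (G_gt0, H_gt0).
by case: z => u; [exists (inr y)|exists (inl x)].
Qed.

Lemma join_constant_le s t : trace_sizes s t -> join_constant G H <= s + t.
Proof.
case; rewrite /join_constant.
have := domination_number_bounds G_gt0; have := domination_number_bounds H_gt0.
case: ifP => [|large]; [lia|case: ifP; lia].
Qed.

Lemma join_constant_attained :
  exists s t, trace_sizes s t /\ s + t = join_constant G H.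
Proof.
have domG := domination_number_bounds G_gt0.
have domH := domination_number_bounds H_gt0.
rewrite /join_constant; case: ifPn => [_|large].
  exists (domination_number G), (domination_number H).
  by split=> //; split; lia.
case: ifPn => [/orP[domG2|domH2]|_].
- by exists 2, 1; split=> //; split; lia.
- by exists 1, 2; split=> //; split; lia.
- by exists 2, 2; split=> //; split; lia.
Qed.

Lemma min_fort_meets_both :
  min_size [pred Z : {set join G H} | fort Z && meets_both Z] =
  Some (join_constant G H).
Proof.
apply: min_size_Some => [|Z /andP[]].
  by have [s [t [/trace_sizes_fort ? <-]]] := join_constant_attained.
rewrite -(sum_set_preim Z) card_sum_set => fortZ /(fort_trace_sizes fortZ).
exact: join_constant_le.
Qed.

End Join.

Theorem theorem4 (G H : sgraph) (hG : 1 <= #|G|) (hH : 1 <= #|H|) :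
  B' (join G H) = B (join G H) /\
  B (join G H) = omin (B' G) (omin (B' H) (Some (join_constant G H))).
Proof.
split; first exact/B'_no_isolated/join_no_isolated.
rewrite B_min_fort min_size_sum min_fort_meets_both // !B'_min_fort.
congr omin; last congr omin; apply: eq_min_size.
- by move=> X; apply: fort_join_set0r.
- by move=> Y; apply: fort_join_set0l.
Qed.
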